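(* Let $\Delta t>0$ and let $(\phi^n,\psi^n,R^n)_{n\ge 0}$ be a sequence produced by the S-GPAV-CN scheme described in the context, i.e. $\phi^0\in H^6_{per}(\Omega)$, $\psi^0=0$, $R^0=\sqrt{E_1[\phi^0,\psi^0]}$, $(\phi^1,\psi^1,R^1)$ satisfies the first-step equations, and for every $n\ge1$ $(\phi^{n+1},\psi^{n+1},R^{n+1})$ satisfies the S-GPAV-CN equations. Then $$\int_\Omega \phi^{n+1}\,dx=\int_\Omega\phi^n\,dx=\cdots=\int_\Omega \phi^0\,dx\qquad\text{for all } n\ge 0 .$$
   Context: Let $d\in\{1,2,3\}$, $L>0$, $\Omega=[0,L]^d$ with periodic boundary conditions; $H^6_{per}(\Omega)$ is the space of real-valued periodic $H^6$ functions on $\Omega$. $\phi^n,\psi^n\in H^6_{per}(\Omega)$ and $R^n\in\mathbb{R}$. $(\cdot,\cdot)$ and $\|\cdot\|$ are the $L^2(\Omega)$ inner product and norm. $L^2_0(\Omega)=\{v\in L^2(\Omega):(v,1)=0\}$. For $v\in L_0^2(\Omega)$, $-\Delta^{-1}v$ denotes the unique $\varphi\in H^2_{per}(\Omega)\cap L^2_0(\Omega)$ with $-\Delta\varphi=v$, and $\|v\|_{-1}=\|\nabla\varphi\|=\sqrt{(-\Delta^{-1}v,v)}$. (All $\psi^n$ generated by the scheme have zero mean.) Parameters: $M>0$; $\alpha,\beta\ge 0$ not both zero; $\epsilon\in(0,1)$; $h_{vac}\ge 0$; stabilization parameter $S>0$. Nonlinearities: $F(\phi)=\frac14\phi^4-\frac{\epsilon}{2}\phi^2$,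 $F_{vac}(\phi)=\frac{h_{vac}}{3}(|\phi|^3-\phi^3)$, $f(\phi)=F'(\phi)=\phi^3-\epsilon\phi$, $f_{vac}(\phi)=F_{vac}'(\phi)=h_{vac}(|\phi|-\phi)\phi$. Shifted energy: $$E_1[\phi,\psi]=\int_\Omega\Big(\frac12|(\Delta+1)\phi|^2+F(\phi)+F_{vac}(\phi)+c_0\Big)dx+\frac{\alpha}{2M}\|\psi\|_{-1}^2,$$ with the constant $c_0$ chosen such that $E_1[\phi,\psi]>0$ for all $\phi$ and all zero-mean $\psi$. Notation for a sequence $(g^n)$: $g^{n+1/2}=\frac{g^{n+1}+g^n}{2}$, $g^{\dagger,n+1}=\frac32 g^n-\frac12 g^{n-1}$, $g^{\star,n+1}=2g^n-g^{n-1}$. S-GPAV-CN equations ($n\ge1$): $$\alpha\frac{\psi^{n+1}-\psi^n}{\Delta t}+\beta\psi^{n+1/2}=M\Delta\mu^{n+1/2},$$ $$\mu^{n+1/2}=(\Delta+1)^2\phi^{n+1/2}+\xi_1^{n+1/2}\big(f(\phi^{\dagger,n+1})+f_{vac}(\phi^{\dagger,n+1})\big)+S(\phi^{n+1}-\phi^{\star,n+1}),$$ $$\psi^{n+1/2}=\frac{\phi^{n+1}-\phi^n}{\Delta t},\qquad \frac{R^{n+1}-R^n}{\Delta t}=-\frac{\beta\,\xi_2^{n+1}}{2M\sqrt{E_1[\phi^{n+1/2},\psi^{n+1/2}]}}\|\psi^{n+1/2}\|_{-1}^2,$$ $$\xi_1^{n+1/2}=\frac{R^{\dagger,n+1}}{\sqrt{E_1[\phi^{\dagger,n+1},\psi^{\dagger,n+1}]}},\qquad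 \xi_2^{n+1}=\frac{R^{n+1}}{\sqrt{E_1[\phi^{n+1},\psi^{n+1}]}} .$$ First-step equations: $$\alpha\frac{\psi^1-\psi^0}{\Delta t}+\beta\psi^1=M\Delta\mu^1,\quad \mu^1=(\Delta+1)^2\phi^1+\frac{R^0}{\sqrt{E_1[\phi^0,\psi^0]}}\big(f(\phi^0)+f_{vac}(\phi^0)\big)+S(\phi^1-\phi^0),$$ $$\frac{\phi^1-\phi^0}{\Delta t}=\psi^1,\quad \frac{R^1-R^0}{\Delta t}=-\frac{\beta R^1}{2M E_1[\phi^1,\psi^1]}\|\psi^1\|_{-1}^2 .$$ *)

(* Defs.v *)
From HB Require Import structures.
From mathcomp Require Import all_boot all_order all_algebra.
From mathcomp Require Import all_classical all_reals all_analysis.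

Set Implicit Arguments.
Unset Strict Implicit.
Unset Printing Implicit Defensive.

Import Order.TTheory GRing.Theory Num.Theory.
Import numFieldNormedType.Exports.

Local Open Scope classical_set_scope.
Local Open Scope ring_scope.

(* Lebesgue measure on R^d.  Points of R^d are d-tuples of reals, because
   these carry the product sigma-algebra. *)

Section LebesgueCons.
Context {R : realType} (n : nat).
Variable m : {measure set (n.-tuple (measurableTypeR R)) -> \bar R}.

Definition tcons (p : n.-tuple (measurableTypeR R) * measurableTypeR R) :
  n.+1.-tuple (measurableTypeR R) := [the n.+1.-tuple _ of p.2 :: p.1].

Lemma measurable_tcons : measurable_fun setT tcons.
Proof. exact: measurable_cons. Qed.

Definition lebesgue_cons : set (n.+1.-tuple (measurableTypeR R)) -> \bar R :=
  pushforward (m \x (@lebesgue_measure R))%E tcons.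

Let pushM := measure_function_pushforward__canonical__measure_function_Measure
  (m \x (@lebesgue_measure R))%E measurable_tcons.

Let lebesgue_cons0 : lebesgue_cons set0 = 0%E.
Proof. exact: (measure0 pushM). Qed.

Let lebesgue_cons_ge0 A : (0 <= lebesgue_cons A)%E.
Proof. exact: (measure_ge0 pushM). Qed.

Let lebesgue_cons_sigma_additive : semi_sigma_additive lebesgue_cons.
Proof. exact: (@measure_semi_sigma_additive _ _ _ pushM). Qed.

HB.instance Definition _ := isMeasure.Build _ _ _ lebesgue_cons
  lebesgue_cons0 lebesgue_cons_ge0 lebesgue_cons_sigma_additive.

End LebesgueCons.

Fixpoint lebesgue_rn {R : realType} (d : nat) :
    {measure set (d.-tuple (measurableTypeR R)) -> \bar R} :=
  match d with
  | 0 => \d_ [tuple]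
  | n.+1 => lebesgue_cons (lebesgue_rn n)
  end.

Definition box {R : realType} (d : nat) (L : R) :
    set (d.-tuple (measurableTypeR R)) :=
  [set t | forall i, 0 <= tnth t i <= L].

Lemma measurable_box {R : realType} (d : nat) (L : R) :
  measurable (@box R d L).
Proof.
have -> : @box R d L = \bigcap_(i in [set: 'I_d])
    ((fun t => tnth t i) @^-1` `[0, L]%classic).
  apply/seteqP; split=> t /= h; first by move=> i _ /=; rewrite in_itv /= h.
  by move=> i; have := h i I; rewrite /= in_itv.
apply: fin_bigcap_measurable => // i _.
by rewrite -[X in measurable X]setTI; apply: measurable_tnth.
Qed.

Section PeriodicSobolev.
Context {R : realType} {d : nat}.
Variable L : R.

Local Notation field := (d.-tuple (measurableTypeR R) -> R).

Definition leb_box : {measure set (d.-tuple (measurableTypeR R)) -> \bar R} :=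
  mrestr (lebesgue_rn d) (@measurable_box R d L).

Local Notation mu := leb_box.

Definition inner (u v : field) : R := \int[mu]_x (u x * v x).

Definition L2 (u : field) : Prop := u \in Lfun mu 2%:E.

Definition L20 (u : field) : Prop := L2 u /\ inner u (cst 1) = 0.

Definition tovec (t : d.-tuple (measurableTypeR R)) : 'rV[R]_d :=
  \row_i tnth t i.

Definition pderiv (v : 'rV[R]_d -> R) (i : 'I_d) : 'rV[R]_d -> R :=
  fun x => 'D_(delta_mx 0 i) v x.

(* L-periodic functions on R^d all of whose iterated partial derivatives exist
   and are continuous. *)
Definition smooth_per (v : 'rV[R]_d -> R) : Prop :=
  (forall (x : 'rV[R]_d) i, v (x + L *: delta_mx 0 i) = v x) /\
  forall s : seq 'I_d, let w := foldl pderiv v s in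
    continuous w /\ forall i x, derivable w x (delta_mx 0 i).

(* Elements of L^2 of the torus are represented by their restrictions to the
   box, up to equality almost everywhere.  The periodicity of the Sobolev
   functions below comes from the test functions, which are periodic and need
   not vanish on the boundary of the box. *)
Definition weak_deriv (i : 'I_d) (u g : field) : Prop :=
  [/\ L2 u, L2 g &
    forall v, smooth_per v ->
      inner u (pderiv v i \o tovec) = - inner g (v \o tovec)].

Fixpoint Hper (m : nat) (u : field) : Prop :=
  match m with
  | 0 => L2 u
  | k.+1 => L2 u /\ forall i, exists2 g, weak_deriv i u g & Hper k g
  end.

(* The weak derivative is unique up to a.e. equality; [wpartial] picks a
   representative (0 if u has no weak derivative). *)
Definition wpartial (i : 'I_d) (u : field) : field :=
  xget (cst 0) [set g | weak_deriv i u g].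

Definition lap (u : field) : field :=
  fun x => \sum_i wpartial i (wpartial i u) x.

Definition lap1 (u : field) : field := fun x => lap u x + u x.

Definition gradnorm (u : field) : R :=
  Num.sqrt (\sum_i inner (wpartial i u) (wpartial i u)).

(* -Delta^{-1} on zero-mean functions, again up to a.e. equality; if v does not
   have zero mean there is no such p and the value is 0. *)
Definition neg_invlap (v : field) : field :=
  xget (cst 0) [set p | [/\ Hper 2 p, L20 p &
    (fun x => - lap p x) = v %[ae mu]]].

Definition Hm1norm (v : field) : R := gradnorm (neg_invlap v).

End PeriodicSobolev.

Section Nonlinearities.
Context {R : realType}.
Implicit Types (eps hvac s : R).

Definition Fpot eps s : R := s ^+ 4 / 4 - eps / 2 * s ^+ 2.
Definition Fvac hvac s : R := hvac / 3 * (`|s| ^+ 3 - s ^+ 3).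
Definition fpot eps s : R := s ^+ 3 - eps * s.
Definition fvac hvac s : R := hvac * (`|s| - s) * s.

End Nonlinearities.

Section TimeAverages.
Context {R : realType} {V : lmodType R}.
Variable g : nat -> V.

(* g^{n+1/2}, g^{dagger,n+1} and g^{star,n+1}; the last two are only used for
   n >= 1. *)
Definition mid n : V := 2^-1 *: (g n.+1 + g n).
Definition dag n : V := (3 / 2) *: g n - 2^-1 *: g n.-1.
Definition star n : V := 2 *: g n - g n.-1.

End TimeAverages.

Section Scheme.
Context {R : realType} {d : nat}.
Variables (L M alpha beta eps hvac stab c0 dt : R).

Local Notation field := (d.-tuple (measurableTypeR R) -> R).
Local Notation mu := (leb_box (d := d) L).

Definition E1 (phi psi : field) : R :=
  \int[mu]_x (2^-1 * `|lap1 L phi x| ^+ 2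
               + Fpot eps (phi x) + Fvac hvac (phi x) + c0)
  + alpha / (2 * M) * Hm1norm L psi ^+ 2.

Variables (phi psi : nat -> field) (r : nat -> R).

Definition mu1 : field := fun x =>
  lap1 L (lap1 L (phi 1%N)) x
  + r 0%N / Num.sqrt (E1 (phi 0%N) (psi 0%N))
    * (fpot eps (phi 0%N x) + fvac hvac (phi 0%N x))
  + stab * (phi 1%N x - phi 0%N x).

Definition first_step : Prop :=
  [/\ (fun x => alpha * ((psi 1%N x - psi 0%N x) / dt) + beta * psi 1%N x)
        = (fun x => M * lap L mu1 x) %[ae mu],
      (fun x => (phi 1%N x - phi 0%N x) / dt) = psi 1%N %[ae mu] &
      (r 1%N - r 0%N) / dt
        = - (beta * r 1%N / (2 * M * E1 (phi 1%N) (psi 1%N)))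
          * Hm1norm L (psi 1%N) ^+ 2].

Definition xi1 n : R := dag r n / Num.sqrt (E1 (dag phi n) (dag psi n)).

Definition xi2 n : R := r n.+1 / Num.sqrt (E1 (phi n.+1) (psi n.+1)).

Definition mu_mid n : field := fun x =>
  lap1 L (lap1 L (mid phi n)) x
  + xi1 n * (fpot eps (dag phi n x) + fvac hvac (dag phi n x))
  + stab * (phi n.+1 x - star phi n x).

Definition cn_step n : Prop :=
  [/\ (fun x => alpha * ((psi n.+1 x - psi n x) / dt) + beta * mid psi n x)
        = (fun x => M * lap L (mu_mid n) x) %[ae mu],
      mid psi n = (fun x => (phi n.+1 x - phi n x) / dt) %[ae mu] &
      (r n.+1 - r n) / dt
        = - (beta * xi2 n / (2 * M * Num.sqrt (E1 (mid phi n) (mid psi n))))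
          * Hm1norm L (mid psi n) ^+ 2].

Definition sgpav_cn : Prop :=
  [/\ forall n, Hper L 6 (phi n) /\ Hper L 6 (psi n),
      psi 0%N = cst 0 %[ae mu],
      r 0%N = Num.sqrt (E1 (phi 0%N) (psi 0%N)),
      first_step &
      forall n, (1 <= n)%N -> cn_step n].

End Scheme.

(* Main.v *)
Require Import Defs.
From HB Require Import structures.
From mathcomp Require Import all_boot all_order all_algebra.
From mathcomp Require Import all_classical all_reals all_analysis.
From mathcomp Require Import ring.

Import Order.TTheory GRing.Theory Num.Theory.
Import numFieldNormedType.Exports.

Local Open Scope classical_set_scope.
Local Open Scope ring_scope.

(** Integrating over the periodic box annihilates every Laplacian: a weak
    derivative has zero integral, as one sees by testing its definition against
    the constant function 1 ([weak_deriv_integral0], [lap_integral0]).  So the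
    integral of the wave equation is a linear recurrence for the integrals of
    psi, in which the potential mu, hence every nonlinear or stabilizing term,
    has disappeared:
      (alpha / dt + k beta) \int psi^(n+1) + b \int psi^n = 0,
    with k = 1 for the first step and k = 1/2 for the later ones.  The leading
    coefficient is positive because alpha and beta are nonnegative and not both
    zero.  As psi^0 = 0, every psi^n has zero mean.  The kinematic equation says
    that (phi^(n+1) - phi^n) / dt is a linear combination of psi^(n+1) and
    psi^n, so that the integral of phi does not change from one step to the
    next ([Rintegral_conserved]).

    Linearity of the integral requires integrability, which the L^2 bounds give
    because the box has finite measure ([lebesgue_rn_box_lty]). *)

(** * Integrals of linear combinations *)

Section RintegralLinear.
Context {R : realType} {disp : measure_display} {T : measurableType disp}.
Context {mu : {measure set T -> \bar R}}.

Local Notation intble u := (mu.-integrable setT (EFin \o u)).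

Lemma integrable_comb {u v : T -> R} (a b : R) : intble u -> intble v ->
  intble (fun x => a * u x + b * v x).
Proof.
move=> iu iv.
exact: (integrableD _ (integrableZl _ a iu) (integrableZl _ b iv)).
Qed.

Lemma Rintegral_comb {u v : T -> R} {a b : R} : intble u -> intble v ->
  \int[mu]_x (a * u x + b * v x) = a * \int[mu]_x u x + b * \int[mu]_x v x.
Proof.
move=> iu iv.
rewrite RintegralD//; first by rewrite !RintegralZl.
- exact: (integrableZl _ a iu).
- exact: (integrableZl _ b iv).
Qed.

Lemma Rintegral_ae_eq {u v : T -> R} : intble u -> intble v ->
  u = v %[ae mu] -> \int[mu]_x u x = \int[mu]_x v x.
Proof.
move=> /measurable_int mu_ /measurable_int mv uv; congr fine.
apply: ae_eq_integral => //.
by apply: filterS uv => x /= h _; rewrite h.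
Qed.

(** Serves with u, v the velocities and p, q the order parameters at two
    consecutive times. *)
Lemma Rintegral_conserved {u v p q : T -> R} {a b dt : R} : dt != 0 ->
  intble u -> intble v -> intble p -> intble q ->
  (fun x => (p x - q x) / dt) = (fun x => a * u x + b * v x) %[ae mu] ->
  a * \int[mu]_x u x + b * \int[mu]_x v x = 0 ->
  \int[mu]_x p x = \int[mu]_x q x.
Proof.
move=> dt0 iu iv ip iq pq.
have {}pq : (fun x => dt^-1 * p x + - dt^-1 * q x) =
    (fun x => a * u x + b * v x) %[ae mu].
  by apply: filterS pq => x /= h _; rewrite -h//; ring.
have := Rintegral_ae_eq (integrable_comb _ _ ip iq) (integrable_comb _ _ iu iv) pq.
rewrite !Rintegral_comb// => + uv0.
rewrite uv0 mulNr -mulrBr => /eqP.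
by rewrite mulf_eq0 invr_eq0 (negbTE dt0) subr_eq0 => /eqP.
Qed.

End RintegralLinear.

(** * The box has finite Lebesgue measure *)

Lemma lebesgue_rn_box_lty (R : realType) (d : nat) (L : R) :
  (lebesgue_rn d (box L) < +oo)%E.
Proof.
elim: d => [|d IHd] /=.
  by rewrite diracE ltry.
rewrite /lebesgue_cons /pushforward.
have -> : @tcons R d @^-1` box L = box L `*` `[0, L].
  apply/seteqP; split => -[t y] /= h.
    split=> [i|].
      by have := h (lift ord0 i); rewrite tnthS.
    by have := h ord0; rewrite tnth0 in_itv.
  case: h => ht; rewrite in_itv /= => hy i.
  by case: (unliftP ord0 i) => [j|] ->; rewrite ?tnthS ?tnth0.
rewrite product_measure1E//; last exact: measurable_box.
rewrite lte_mul_pinfty //.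
  by rewrite ge0_fin_numE.
change (lebesgue_measure `[0%R, L]%classic < +oo)%E.
by rewrite lebesgue_measure_itv /=; case: ifP; rewrite ?ltry.
Qed.

(** * Laplacians have zero integral over the periodic box *)

Section Torus.
Context {R : realType} {d : nat} {L : R}.

Local Notation field := (d.-tuple (measurableTypeR R) -> R).
Local Notation mu := (leb_box (d := d) L).
Local Notation intble u := (mu.-integrable setT (EFin \o u)).

Lemma L2_integrable {u : field} : L2 L u -> intble u.
Proof.
move=> hu; apply/Lfun1_integrable/Lfun_subset12 => //.
rewrite ge0_fin_numE// /leb_box/= /mrestr setTI; exact: lebesgue_rn_box_lty.
Qed.

Lemma Hper_integrable {m : nat} {u : field} : Hper L m u -> intble u.
Proof. by case: m => [|m] => [|[+ _]] => /L2_integrable. Qed.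

Lemma foldl_pderiv_cst (s : seq 'I_d) (c : R) :
  exists c', foldl pderiv (cst c) s = cst c'.
Proof.
elim: s c => [|i s IHs] c /=; first by exists c.
suff -> : pderiv (cst c) i = cst 0 by exact: IHs.
by apply/funext => x; rewrite /pderiv derive_cst.
Qed.

Lemma smooth_per_cst (c : R) : smooth_per (d := d) L (cst c).
Proof.
split=> // s; have [c' ->] := foldl_pderiv_cst s c.
by split=> [|i x]; [exact: cst_continuous|exact: derivable_cst].
Qed.

(** Periodic test functions need not vanish on the boundary, so the constant 1
    is one of them; its derivative is 0. *)
Lemma weak_deriv_integral0 {i : 'I_d} {u g : field} :
  weak_deriv L i u g -> \int[mu]_x g x = 0.
Proof.
move=> [_ _ /(_ _ (smooth_per_cst 1))]; rewrite /inner.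
under eq_Rintegral do rewrite /= /pderiv derive_cst mulr0.
under [in RHS]eq_Rintegral do rewrite /= mulr1.
rewrite Rintegral_cst// mul0r => /esym/eqP.
by rewrite oppr_eq0 => /eqP.
Qed.

(** Lets statements about [wpartial] hold for arbitrary fields: the default
    value 0 is integrable with zero integral, like a genuine derivative. *)
Lemma wpartial_weak_deriv (i : 'I_d) (u : field) :
  weak_deriv L i u (wpartial L i u) \/ wpartial L i u = cst 0.
Proof.
by rewrite /wpartial; case: xgetP => [g -> ?|_]; [left|right].
Qed.

Lemma wpartial_integrable (i : 'I_d) (u : field) : intble (wpartial L i u).
Proof.
have [[_ + _]|->] := wpartial_weak_deriv i u; first exact: L2_integrable.
exact: integrable0.
Qed.

Lemma wpartial_integral0 (i : 'I_d) (u : field) :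
  \int[mu]_x wpartial L i u x = 0.
Proof.
have [/weak_deriv_integral0//|->] := wpartial_weak_deriv i u.
by rewrite Rintegral_cst// mul0r.
Qed.

Lemma lap_integrable (u : field) : intble (lap L u).
Proof.
have -> : EFin \o lap L u =
    (fun x => \sum_(i < d) (wpartial L i (wpartial L i u) x)%:E)%E.
  by apply/funext => x /=; rewrite /lap sumEFin.
by apply: integrable_sum => // i _; exact: wpartial_integrable.
Qed.

Lemma lap_integral0 (u : field) : \int[mu]_x lap L u x = 0.
Proof.
rewrite /Rintegral /lap; under eq_integral do rewrite -sumEFin.
rewrite integral_sum//; last by move=> i; exact: wpartial_integrable.
rewrite -sum_fine => [|i _]; last first.
  by apply: integrable_fin_num => //; exact: wpartial_integrable.
by apply: big1 => i _; exact: wpartial_integral0.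
Qed.

Lemma comb_eq_lap_integral0 {u v w : field} {a b c : R} :
  intble u -> intble v ->
  (fun x => a * u x + b * v x) = (fun x => c * lap L w x) %[ae mu] ->
  a * \int[mu]_x u x + b * \int[mu]_x v x = 0.
Proof.
move=> iu iv uv; rewrite -Rintegral_comb//.
have il := lap_integrable w.
rewrite (Rintegral_ae_eq _ _ uv); last 2 first.
- exact: integrable_comb.
- exact: (integrableZl _ c il).
by rewrite RintegralZl// lap_integral0 mulr0.
Qed.

End Torus.

(** * Mass conservation *)

Theorem theorem3p3 (R : realType) (d : nat)
  (L M alpha beta eps hvac stab c0 dt : R)
  (phi psi : nat -> d.-tuple (measurableTypeR R) -> R) (r : nat -> R)
  (hd : (1 <= d <= 3)%N) (hL : 0 < L) (hM : 0 < M)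
  (halpha : 0 <= alpha) (hbeta : 0 <= beta)
  (hab : ~ (alpha = 0 /\ beta = 0))
  (heps : 0 < eps < 1) (hhvac : 0 <= hvac) (hS : 0 < stab)
  (hc0 : forall p q : d.-tuple (measurableTypeR R) -> R,
      Hper L 2 p -> L20 L q -> 0 < E1 L M alpha eps hvac c0 p q)
  (hdt : 0 < dt)
  (hscheme : sgpav_cn L M alpha beta eps hvac stab c0 dt phi psi r) :
  forall n : nat,
    \int[leb_box L]_x phi n.+1 x = \int[leb_box L]_x phi n x /\
    \int[leb_box L]_x phi n x = \int[leb_box L]_x phi 0%N x.
Proof.
case: hscheme => hreg hpsi0 _ [wave1 kin1 _] hcn.
have iphi n := Hper_integrable (hreg n).1.
have ipsi n := Hper_integrable (hreg n).2.
have dt0 : dt != 0 by rewrite gt_eqF.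
have midE (g : nat -> d.-tuple (measurableTypeR R) -> R) n x :
  mid g n x = 2^-1 * (g n.+1 x + g n x) by [].
have lead_neq0 k : 0 < k -> alpha / dt + k * beta != 0.
  move=> k0; apply/negP; rewrite paddr_eq0; last 2 first.
  - by rewrite divr_ge0// ltW.
  - by rewrite mulr_ge0// ltW.
  rewrite !mulf_eq0 invr_eq0 (negbTE dt0) (gt_eqF k0) orbF /=.
  by move=> /andP[/eqP a0 /eqP b0]; apply: hab.
have psi_mean0 n : \int[leb_box L]_x psi n x = 0.
  elim: n => [|n IHn].
    rewrite (Rintegral_ae_eq (ipsi 0%N) _ hpsi0); last exact: integrable0.
    by rewrite Rintegral_cst// mul0r.
  (* Backward Euler damping gives k = 1 in the first step, the midpoint rule
     k = 1/2 afterwards. *)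
  have [k [k0 [b [w wave]]]] : exists k, 0 < k /\ exists b w,
      (fun x => (alpha / dt + k * beta) * psi n.+1 x + b * psi n x) =
      (fun x => M * lap L w x) %[ae leb_box L].
    case: n {IHn} => [|n].
      exists 1; split=> //; exists (- (alpha / dt)).
      exists (mu1 L M alpha eps hvac stab c0 phi psi r).
      by apply: filterS wave1 => x /= h _; rewrite -h//; ring.
    have [wave _ _] := hcn n.+1 isT.
    exists 2^-1; split; first by rewrite invr_gt0.
    exists (beta / 2 - alpha / dt).
    exists (mu_mid L M alpha eps hvac stab c0 phi psi r n.+1).
    by apply: filterS wave => x /= h _; rewrite -h// midE; ring.
  have /eqP := comb_eq_lap_integral0 (ipsi n.+1) (ipsi n) wave.
  by rewrite IHn mulr0 addr0 mulf_eq0 (negbTE (lead_neq0 _ k0)) => /eqP.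
have step n : \int[leb_box L]_x phi n.+1 x = \int[leb_box L]_x phi n x.
  have [a [b kin]] : exists a b,
      (fun x => (phi n.+1 x - phi n x) / dt) =
      (fun x => a * psi n.+1 x + b * psi n x) %[ae leb_box L].
    case: n => [|n].
      by exists 1, 0; apply: filterS kin1 => x /= h _; rewrite h//; ring.
    have [_ kin _] := hcn n.+1 isT.
    by exists 2^-1, 2^-1; apply: filterS kin => x /= h _; rewrite -h// midE; ring.
  apply: (Rintegral_conserved dt0 (ipsi _) (ipsi _) (iphi _) (iphi _) kin).
  by rewrite !psi_mean0 !mulr0 addr0.
by move=> n; split=> //; elim: n => // n IHn; rewrite step.
Qed.
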